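(* Let $f:\mathbb{Z}^2\to[0,\infty)$ be a function such that for all $(i,j)\in\mathbb{Z}^2$ $$f(i,j)=\frac14\Bigl(f(i-1,j)+f(i+1,j)+f(i,j-1)+f(i,j+1)\Bigr).$$ Then $f$ is constant.
   Context: The squares of the integer lattice in the plane are labeled by their lower-left vertices $(i,j)\in\mathbb{Z}^2$, and $f(i,j)$ is the number written into the square $(i,j)$. The four neighbors of the square $(i,j)$ are the squares $(i\pm1,j)$ and $(i,j\pm1)$. *)

(* Defs.v *)
From mathcomp Require Import all_boot all_order all_algebra.
From mathcomp Require Import reals.

Set Implicit Arguments.
Unset Strict Implicit.
Unset Printing Implicit Defensive.

(* Main.v *)
Require Import Defs.
From mathcomp Require Import all_boot all_order all_algebra.
From mathcomp Require Import reals.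
From mathcomp Require Import zify ring lra.

Set Implicit Arguments.
Unset Strict Implicit.
Unset Printing Implicit Defensive.

Import Order.TTheory GRing.Theory Num.Theory.
Local Open Scope ring_scope.

(** A direct proof of the recurrence criterion for the planar lattice. If [g] is
    positive and harmonic and [phi] has finite support, summing the equation for
    [g] against [phi ^+ 2 / g] and using, on each edge,
    [(p^2/a - q^2/b)(a - b) = (p - q)^2 - (p b - q a)^2 / (a b)]
    shows that the sum of [(p b - q a)^2 / (a b)] over all edges is the Dirichlet
    energy of [phi]. For a cutoff decreasing like the harmonic sum [H_N] in the
    sup norm, the energy is [O(H_N)] while [phi] is [H_N - 1] at the two ends of
    an edge at the centre; there it gives [(a - b)^2 = O(1 / H_N)], so [a = b]. *)

Lemma sum_by_parts (R : comPzRingType) (u g : nat -> R) (M : nat) :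
  u 0 = 0 -> u M = 0 ->
  \sum_(a < M) u a.+1 * (g a.+1 *+ 2 - g a - g a.+2) =
  \sum_(a < M) (u a - u a.+1) * (g a - g a.+1).
Proof.
move=> u0 uM.
(* The boundary terms are kept so that the identity holds for every [M] and can be proved by
   induction. *)
suff -> : \sum_(a < M) u a.+1 * (g a.+1 *+ 2 - g a - g a.+2) =
  \sum_(a < M) (u a - u a.+1) * (g a - g a.+1)
    - u 0 * (g 0 - g 1) + u M * (g M - g M.+1).
  by rewrite u0 uM; ring.
elim: M {uM} => [|M IH]; first by rewrite !big_ord0; ring.
by rewrite !big_ord_recr /= IH; ring.
Qed.

(** Summation by parts with [u = p ^+ 2 / g], followed by the edge identity on each edge. *)
Lemma row_energy (R : realFieldType) (p g : nat -> R) (M : nat) :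
  (forall a, 0 < g a) -> p 0 = 0 -> p M = 0 ->
  \sum_(a < M) p a.+1 ^+ 2 / g a.+1 * (g a.+1 *+ 2 - g a - g a.+2) =
  \sum_(a < M) (p a - p a.+1) ^+ 2 -
  \sum_(a < M) (p a * g a.+1 - p a.+1 * g a) ^+ 2 / (g a * g a.+1).
Proof.
move=> g_gt0 p0 pM.
rewrite (@sum_by_parts _ (fun a => p a ^+ 2 / g a)); last 2 first.
- by rewrite p0 expr0n mul0r.
- by rewrite pM expr0n mul0r.
rewrite -sumrB; apply: eq_bigr => a _.
by have := g_gt0 a; have := g_gt0 a.+1 => ga' ga; field; rewrite !gt_eqF.
Qed.

(** Add [row_energy] over all rows and all columns: the left-hand sides cancel by the mean value
    property. The nonnegative sum over vertical edges is then dropped. *)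
Lemma caccioppoli (R : realFieldType) (phi g : nat -> nat -> R) (M : nat) :
  (forall a b, 0 < g a b) ->
  (forall a b, g a.+1 b.+1 *+ 4 =
    g a b.+1 + g a.+2 b.+1 + g a.+1 b + g a.+1 b.+2) ->
  (forall a, [/\ phi 0 a = 0, phi M a = 0, phi a 0 = 0 & phi a M = 0]) ->
  \sum_(b < M) \sum_(a < M)
    (phi a b.+1 * g a.+1 b.+1 - phi a.+1 b.+1 * g a b.+1) ^+ 2
      / (g a b.+1 * g a.+1 b.+1) <=
  \sum_(b < M) \sum_(a < M) (phi a b.+1 - phi a.+1 b.+1) ^+ 2 +
  \sum_(a < M) \sum_(b < M) (phi a.+1 b - phi a.+1 b.+1) ^+ 2.
Proof.
move=> g_gt0 g_mean phi0.
have H : \sum_(b < M) \sum_(a < M) phi a.+1 b.+1 ^+ 2 / g a.+1 b.+1 *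
      (g a.+1 b.+1 *+ 2 - g a b.+1 - g a.+2 b.+1) +
    \sum_(a < M) \sum_(b < M) phi a.+1 b.+1 ^+ 2 / g a.+1 b.+1 *
      (g a.+1 b.+1 *+ 2 - g a.+1 b - g a.+1 b.+2) = 0.
  rewrite [X in _ + X]exchange_big -big_split big1 //= => b _.
  rewrite -big_split big1 //= => a _.
  rewrite -mulrDr [X in _ * X](_ : _ = 0) ?mulr0 //.
  by have := g_mean a b; lra.
move: H.
have rowE b := @row_energy _ (phi^~ b.+1) (g^~ b.+1) M (fun a => g_gt0 a _).
have colE a := @row_energy _ (phi a.+1) (g a.+1) M (g_gt0 _).
under eq_bigr => b _ do [have [? ? _ _] := phi0 b.+1; rewrite rowE //].
under [X in _ + X]eq_bigr => a _ do [have [_ _ ? ?] := phi0 a.+1; rewrite colE //].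
rewrite !sumrB.
set A := \sum_(b < M) _; set B := \sum_(b < M) _.
set C := \sum_(b < M) _; set D := \sum_(b < M) _ => H.
have D_ge0 : 0 <= D.
  apply: sumr_ge0 => a _; apply: sumr_ge0 => b _.
  by rewrite divr_ge0 ?sqr_ge0 // mulr_ge0 // ltW.
lra.
Qed.

(* Distance to [N] of the nearer end of the edge from [a] to [a + 1]. *)
Definition edge_dist (N a : nat) : nat :=
  if (a < N)%N then (N.-1 - a)%N else (a - N)%N.

Lemma sum_edge_dist (R : nmodType) (N : nat) (G : nat -> R) :
  \sum_(a < N + N) G (edge_dist N a) = (\sum_(k < N) G k) *+ 2.
Proof.
rewrite big_split_ord mulr2n /=; congr (_ + _); last first.
  by apply: eq_bigr => i _; rewrite /edge_dist ltnNge leq_addr addKn.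
rewrite (reindex_inj rev_ord_inj); apply: eq_bigr => i _ /=.
rewrite /edge_dist; have iN := ltn_ord i; rewrite ifT; last by lia.
by congr G; lia.
Qed.

Lemma harmonic_sum_unbounded (R : archiRealFieldType) (C : R) :
  exists N : nat, C < \sum_(k < N) k.+1%:R^-1.
Proof.
(* Doubling the range adds [2 ^ n] terms, each at least [1 / 2 ^ n.+1]. *)
have H n : n%:R / 2 <= \sum_(k < 2 ^ n) (k.+1%:R^-1 : R).
  elim: n => [|n IH]; first by rewrite mul0r; apply: sumr_ge0 => k _; rewrite invr_ge0.
  rewrite expnS mul2n -addnn big_split_ord /=.
  have -> : n.+1%:R / 2 = n%:R / 2 + 2^-1 :> R by rewrite -natr1; field.
  apply: lerD => //.
  have -> : 2^-1 = \sum_(k < 2 ^ n) ((2 ^ n.+1)%:R^-1 : R).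
    rewrite sumr_const card_ord -mulr_natl expnS natrM.
    by field; rewrite pnatr_eq0 -lt0n expn_gt0.
  apply: ler_sum => k _; rewrite lef_pV2 ?posrE ?ltr0n ?expn_gt0 // ler_nat.
  by have := ltn_ord k; rewrite expnS; lia.
set n := Num.bound `|2 * C|; exists (2 ^ n)%N; apply: lt_le_trans (H _).
rewrite ltr_pdivlMr // mulrC; apply: le_lt_trans (ler_norm _) _.
exact: archi_boundP.
Qed.

Definition dist (a b : nat) : nat := ((a - b) + (b - a))%N.

(* Zero at [k = 0], so that the cutoff takes the same value at the centre and at
   its neighbours. *)
Definition increment (R : fieldType) (k : nat) : R :=
  if k is 0 then 0 else k.+1%:R^-1.

(** For [1 <= k <= N] this is [H_N - H_k], with [k] the sup-norm distance to the centre [(N, N)]. *)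
Definition cutoff (R : fieldType) (N k : nat) : R :=
  \sum_(k <= i < N) increment R i.

Lemma cutoff_geq (R : fieldType) (N k : nat) : (N <= k)%N -> cutoff R N k = 0.
Proof. by move=> Nk; rewrite /cutoff big_geq. Qed.

Lemma cutoff_diff (R : fieldType) (N k : nat) :
  (k < N)%N -> cutoff R N k = increment R k + cutoff R N k.+1.
Proof. by move=> kN; rewrite /cutoff big_ltn. Qed.

(** In a row at height [m] from the centre, the sup norm equals [m] at both ends of the edge unless
    [m <= edge_dist N a]; in that case it changes by one. *)
Lemma cutoff_row_diff (R : realFieldType) (N a m : nat) : (a < N + N)%N ->
  (cutoff R N (maxn (dist a N) m) - cutoff R N (maxn (dist a.+1 N) m)) ^+ 2 =
  (m <= edge_dist N a)%:R * increment R (edge_dist N a) ^+ 2.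
Proof.
move=> aN; rewrite /edge_dist.
case: ifP => aN'.
  have -> : dist a N = (N.-1 - a).+1 by rewrite /dist; lia.
  have -> : dist a.+1 N = (N.-1 - a)%N by rewrite /dist; lia.
  case: leqP => mk.
    rewrite (maxn_idPl (leqW mk)) [X in _ - X]cutoff_diff; last by lia.
    by rewrite mul1r; ring.
  by rewrite (maxn_idPr mk) mul0r subrr expr0n.
have -> : dist a N = (a - N)%N by rewrite /dist; lia.
have -> : dist a.+1 N = (a - N).+1 by rewrite /dist; lia.
case: leqP => mk.
  rewrite (maxn_idPl (leqW mk)) [X in X - _]cutoff_diff; last by lia.
  by rewrite mul1r; ring.
by rewrite (maxn_idPr mk) mul0r subrr expr0n.
Qed.

(** For each [k < N], two edges per row lie at distance [k], and at most [2 * k.+1] rows contribute,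
    each edge giving at most [1 / k.+1 ^ 2]. *)
Lemma cutoff_energy (R : realFieldType) (N : nat) :
  \sum_(b < N + N) \sum_(a < N + N)
    (cutoff R N (maxn (dist a N) (dist b.+1 N))
     - cutoff R N (maxn (dist a.+1 N) (dist b.+1 N))) ^+ 2
  <= 4 * \sum_(k < N) k.+1%:R^-1.
Proof.
under eq_bigr => b _.
  under eq_bigr => a _ do rewrite cutoff_row_diff //.
  rewrite (@sum_edge_dist _ _ (fun k => (dist b.+1 N <= k)%:R * increment R k ^+ 2)).
  over.
rewrite /= sumrMnl exchange_big /= -sumrMnl mulr_sumr; apply: ler_sum => k _.
rewrite -mulr_suml.
have count : \sum_(b < N + N) (dist b.+1 N <= k)%:R <= (2 * k.+1)%:R :> R.
  rewrite -natr_sum ler_nat.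
  apply: (@leq_trans (\sum_(b < N + N) (edge_dist N b <= k))).
    apply: leq_sum => b _; have : (edge_dist N b <= dist b.+1 N)%N.
      by rewrite /edge_dist /dist; case: ifP; lia.
    by case: leqP => //; case: leqP => //; lia.
  rewrite (@sum_edge_dist nat N (fun b => (b <= k)%N : nat)) mulr2n mul2n -addnn.
  have -> : (\sum_(b < N) (b <= k) = minn N k.+1)%N.
    elim: {k}N (k : nat) => [|n IH] k; first by rewrite big_ord0 min0n.
    by rewrite big_ord_recr /= IH; lia.
  by rewrite leq_add ?geq_minr.
have incr : increment R k ^+ 2 <= k.+1%:R^-1 ^+ 2.
  by case: (nat_of_ord k) => [|j] //=; rewrite expr0n /= sqr_ge0.
apply: le_trans (_ : ((2 * k.+1)%:R * k.+1%:R^-1 ^+ 2) *+ 2 <= _).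
  by rewrite lerMn2r ler_pM ?orbT ?sqr_ge0 ?sumr_ge0.
have : k.+1%:R != 0 :> R by rewrite pnatr_eq0.
rewrite natrM; move: (k.+1%:R) => z z_neq0.
by rewrite le_eqVlt; apply/orP; left; apply/eqP; field.
Qed.

Lemma harmonic_sum_cutoff (R : fieldType) (N : nat) : (0 < N)%N ->
  \sum_(k < N) k.+1%:R^-1 = 1 + cutoff R N 1.
Proof.
move=> N_gt0; rewrite -(big_mkord xpredT (fun k => k.+1%:R^-1)) big_ltn // invr1.
by congr (_ + _); apply: eq_big_nat => -[].
Qed.

Lemma le_double_sum (R : numDomainType) (M : nat) (F : nat -> nat -> R) (a b : nat) :
  (a < M)%N -> (b < M)%N -> (forall a b, 0 <= F a b) ->
  F a b <= \sum_(b < M) \sum_(a < M) F a b.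
Proof.
move=> aM bM F_ge0.
rewrite (bigD1 (Ordinal bM)) //= (bigD1 (Ordinal aM)) //= -addrA lerDl.
by rewrite addr_ge0 ?sumr_ge0 // => i _; rewrite sumr_ge0.
Qed.

Lemma positive_harmonic_step (R : archiRealFieldType) (g : int -> int -> R) :
  (forall i j, 0 < g i j) ->
  (forall i j, g i j *+ 4 =
     g (i - 1) j + g (i + 1) j + g i (j - 1) + g i (j + 1)) ->
  forall i j, g i j = g (i + 1) j.
Proof.
move=> g_gt0 g_mean x y.
set p := g x y; set q := g (x + 1) y.
have p_gt0 : 0 < p by apply: g_gt0.
have q_gt0 : 0 < q by apply: g_gt0.
apply/eqP; rewrite -subr_eq0 -sqrf_eq0; apply: contraT => pq.
have d_gt0 : 0 < (p - q) ^+ 2 by rewrite lt_def pq sqr_ge0.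
(* As [H_N = 1 + h] with [h] the central cutoff value, this gives [h > 1 + C], where [C] is the
   fraction: both [h > 1] and [h > C] are needed. *)
have [N HN] := @harmonic_sum_unbounded R (2 + 16 * (p * q) / (p - q) ^+ 2).
have C_ge0 : 0 <= 16 * (p * q) / (p - q) ^+ 2.
  by rewrite divr_ge0 ?sqr_ge0 ?mulr_ge0 ?(ltW p_gt0) ?(ltW q_gt0).
have N_gt0 : (0 < N)%N.
  by case: (N) HN => //; rewrite big_ord0 => ?; lra.
pose phi a b := cutoff R N (maxn (dist a N) (dist b N)).
(* Translate so that [(x, y)] becomes the centre [(N, N)] of the window. *)
pose G (a b : nat) := g (x + a%:Z - N%:Z) (y + b%:Z - N%:Z).
have phi_sym a b : phi a b = phi b a by rewrite /phi maxnC.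
have phi0 a b : (a == 0%N) || (a == N + N)%N -> phi a b = 0.
  by move=> aN; apply: cutoff_geq; rewrite /dist; lia.
have G_mean a b : G a.+1 b.+1 *+ 4 =
    G a b.+1 + G a.+2 b.+1 + G a.+1 b + G a.+1 b.+2.
  rewrite /G g_mean; congr (g _ _ + g _ _ + g _ _ + g _ _); lia.
have phi00 a :
    [/\ phi 0 a = 0, phi (N + N)%N a = 0, phi a 0 = 0 & phi a (N + N)%N = 0].
  by rewrite !(phi_sym a) !phi0 ?eqxx ?orbT.
have := @caccioppoli R phi G (N + N) (fun _ _ => g_gt0 _ _) G_mean phi00.
under [X in _ <= _ + X]eq_bigr => a _ do
  under eq_bigr => b _ do rewrite (phi_sym _ b) (phi_sym _ b.+1).
have E := @cutoff_energy R N.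
move=> H; have {}H := le_trans H (lerD E E).
have term_ge0 a b : 0 <=
    (phi a b.+1 * G a.+1 b.+1 - phi a.+1 b.+1 * G a b.+1) ^+ 2
      / (G a b.+1 * G a.+1 b.+1).
  exact: divr_ge0 (sqr_ge0 _) (ltW (mulr_gt0 (g_gt0 _ _) (g_gt0 _ _))).
have N_ltNN : (N < N + N)%N by rewrite -[X in (X < _)%N]addn0 ltn_add2l.
have N1_ltNN := leq_ltn_trans (leq_pred N) N_ltNN.
(* Keep only the edge from [(N, N)] to [(N.+1, N)]; its row index is [N.-1] because the summand uses
   [b.+1]. *)
have := le_trans (le_double_sum N_ltNN N1_ltNN term_ge0) H; rewrite prednK //.
have -> : G N N = p by rewrite /G !addrK.
have -> : G N.+1 N = q by rewrite /G intS addrA !addrK.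
have -> : phi N.+1 N = cutoff R N 1 by rewrite /phi /dist subSnn subnn subnS subnn.
have -> : phi N N = cutoff R N 1.
  by rewrite /phi /dist subnn cutoff_diff // add0r.
rewrite harmonic_sum_cutoff // in HN *.
set h := cutoff R N 1 in HN *.
set C := 16 * (p * q) / (p - q) ^+ 2 in HN C_ge0.
have CE : C * (p - q) ^+ 2 = 16 * (p * q) by rewrite /C divfK.
rewrite ler_pdivrMr ?mulr_gt0 // -mulrBr exprMn -[(q - p) ^+ 2]sqrrN opprB => le1.
have h_gt1 : 1 < h by lra.
(* The energy bound [8 * (1 + h)] is at most [16 * h] since [h > 1]; this is the source of the 16 in
   [C]. *)
have le2 : h ^+ 2 * (p - q) ^+ 2 <= h * C * (p - q) ^+ 2.
  rewrite -mulrA CE; apply: le_trans le1 _.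
  have : 0 <= (h - 1) * (p * q) by rewrite !mulr_ge0 ?ltW // subr_gt0.
  by lra.
have : h * (h - C) <= 0.
  by rewrite -(pmulr_lle0 _ d_gt0); lra.
by rewrite pmulr_rle0 ?subr_le0; lra.
Qed.

Lemma int_step_constant (T : Type) (u : int -> T) :
  (forall i, u i = u (i + 1)) -> forall i, u i = u 0.
Proof.
move=> uS; elim/int_rect => // n IH; first by rewrite -IH [RHS]uS; congr u; lia.
by rewrite uS -IH; congr u; lia.
Qed.

Theorem mainTheorem2 (R : realType) (f : int * int -> R)
    (f_ge0 : forall i j : int, 0 <= f (i, j))
    (f_mean : forall i j : int,
      f (i, j) =
        1 / 4 * (f (i - 1, j) + f (i + 1, j) + f (i, j - 1) + f (i, j + 1))) :
  exists c : R, forall i j : int, f (i, j) = c.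
Proof.
(* Adding 1 keeps the mean value property and makes the function positive, so that division by it is
   allowed. *)
have f1_gt0 i j : 0 < f (i, j) + 1 by rewrite ltr_wpDl.
have stepx i j : f (i, j) = f (i + 1, j).
  apply: (@addIr _ 1).
  apply: (@positive_harmonic_step _ (fun i j => f (i, j) + 1)) => // {}i {}j.
  by have := f_mean i j; lra.
have stepy i j : f (i, j) = f (i, j + 1).
  apply: (@addIr _ 1).
  apply: (@positive_harmonic_step _ (fun j i => f (i, j) + 1)) => // {}j {}i.
  by have := f_mean i j; lra.
exists (f (0, 0)) => i j.
rewrite (int_step_constant (u := fun i => f (i, j))) //.
by rewrite (int_step_constant (u := fun j => f (0, j))).
Qed.
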